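(* Consider any scenario subproblem, i.e. any instance of the deterministic multi-component replacement problem described in the context, with component set $N=\{1,\dots,n\}$, planning horizon $T_s=\{1,\dots,T\}$, lifetimes $T_{ir}$ and costs $c_{i,\mathrm{pr}}<c_{i,\mathrm{cr}}$, $d$. Then there exists an optimal solution of the scenario subproblem with the following property: for every decision period $t\in T_s$ at which the group $G_t$ of individuals replaced at $t$ is nonempty (one-individual groups included), and such that $G_t$ does not consist entirely of individuals that are the last individual of their component type replaced in the planning horizon, there is at least one individual $I_{ir}\in G_t$ whose not-used residual lifetime satisfies $\varepsilon_{ir}\le 1$; that is, at least one individual of the group is replaced exactly at its failure time or exactly one time unit before its failure time.
   Context: Scenario subproblem. There are $n$ component types $N=\{1,\dots,n\}$ and decision periods $T_s=\{1,\dots,T\}$. For each $i\in N$ and $r=1,\dots,q$, $I_{ir}$ denotes the $r$-th individual (physical part) used for component type $i$. In a fixed scenario it has a known positive integer lifetime $T_{ir}$; $T_{i1}$ is the remaining lifetime of the initially installed individual, counted from time $0$. The number $q$ of available individuals per type is large enough that individuals never run out (e.g. $q\ge T+1$). A component that is found failed at the first stage has $T_{i1}=1$, so that it must be replaced, correctively, at time $1$. A feasible solution specifies, for each $i\in N$, an integer $k_i\ge 0$ and integer replacement times $0=\tau_{i0}<\tau_{i1}<\dots<\tau_{ik_i}\le T$, where $\tau_{ir}$ (for $1\le r\le k_i$) is the time at which $I_{ir}$ is replaced by $I_{i,r+1}$, such that: (i) $\tau_{ir}\le \tau_{i,r-1}+T_{ir}$ for $1\le r\le k_i$ (each individual is replaced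 no later than its failure time $\tau_{i,r-1}+T_{ir}$); (ii) $\tau_{ik_i}+T_{i,k_i+1}>T$ (the individual in use at the end of the horizon does not fail within the horizon). Costs. The replacement of $I_{ir}$ is corrective, with cost $c_{i,\mathrm{cr}}$, if $\tau_{ir}=\tau_{i,r-1}+T_{ir}$, and preventive, with cost $c_{i,\mathrm{pr}}$, if $\tau_{ir}<\tau_{i,r-1}+T_{ir}$, where $0\le c_{i,\mathrm{pr}}<c_{i,\mathrm{cr}}$ for all $i$. In addition, a setup cost $d\ge 0$ is incurred once for every $t\in T_s$ at which at least one individual is replaced, regardless of how many are replaced then. The objective is to minimize the total cost (all replacement costs plus all setup costs); an optimal solution is a feasible solution of minimum total cost. Groups. For a feasible solution and $t\in T_s$, the group at $t$ is $G_t=\{I_{ir}: 1\le r\le k_i,\ \tau_{ir}=t\}$. The not-used residual lifetime of a replaced individual $I_{ir}$ is $\varepsilon_{ir}=\tau_{i,r-1}+T_{ir}-\tau_{ir}\ge 0$. The last individual of component type $i$ replaced in the planning horizon is $I_{ik_i}$ (when $k_i\ge1$). *)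

(* Defs.v *)
From HB Require Import structures.
From mathcomp Require Import all_boot all_order all_algebra.

Set Implicit Arguments.
Unset Strict Implicit.
Unset Printing Implicit Defensive.

Import Order.TTheory GRing.Theory Num.Theory.

(* A replacement plan for n component types: nrep s i is k_i and tau s i r is
   tau_{ir}.  Only the values tau s i r with 0 <= r <= nrep s i matter. *)
Record plan (n : nat) := Plan {
  nrep : 'I_n -> nat;
  tau : 'I_n -> nat -> nat
}.

Section Replacement.
Variables (R : realFieldType) (n T q : nat).
(* life i r is the lifetime T_{ir}, with r counted from 1 to q. *)
Variable life : 'I_n -> nat -> nat.
Variables (cpr ccr : 'I_n -> R) (d : R).
Implicit Types (s : plan n) (i : 'I_n) (r t : nat).

Definition failure_time s i r : nat := (tau s i r.-1 + life i r)%N.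

Definition feasible s : Prop :=
  forall i,
    [/\ tau s i 0 = 0%N,
        forall r, (1 <= r <= nrep s i)%N -> (tau s i r.-1 < tau s i r)%N,
        (tau s i (nrep s i) <= T)%N,
        forall r, (1 <= r <= nrep s i)%N -> (tau s i r <= failure_time s i r)%N
      & (T < failure_time s i (nrep s i).+1)%N].

(* The pair (i, r) stands for the individual I_{ir}; the index r = 0 names no
   individual and is excluded from every group. *)
Definition group s t : {set 'I_n * 'I_q.+1} :=
  [set p : 'I_n * 'I_q.+1 | (1 <= p.2 <= nrep s p.1)%N && (tau s p.1 p.2 == t)].

(* For a feasible plan the truncated subtraction is exact whenever
   1 <= r <= nrep s i. *)
Definition residual_life s i r : nat := (failure_time s i r - tau s i r)%N.

Definition last_replaced s i r : bool := r == nrep s i.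

Local Open Scope ring_scope.

Definition replacement_cost s i r : R :=
  if tau s i r == failure_time s i r then ccr i else cpr i.

Definition total_cost s : R :=
  \sum_(i < n) \sum_(1 <= r < (nrep s i).+1) replacement_cost s i r
  + \sum_(1 <= t < T.+1 | group s t != set0) d.

Definition optimal s : Prop :=
  feasible s /\ forall s', feasible s' -> total_cost s <= total_cost s'.

End Replacement.

(* Main.v *)
(** Among the optimal plans, take one whose replacements are as late as
    possible.  If every individual of the group at [t] had residual life at
    least 2, delay the whole group by one period; whenever the successor of a
    delayed individual was replaced in the very next period, delay that
    replacement as well, and so on; a replacement pushed to [T + 1] is dropped.
    Residual lives decrease only in the group at [t], where they stay positive,
    so no replacement becomes corrective.  The set of replacement times loses
    [t] and gains at most the first unused time after [t].  Hence the new plan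
    is still optimal and strictly later, a contradiction. *)

Require Import Defs.
From mathcomp Require Import all_boot all_order all_algebra.
From mathcomp Require Import zify.
Import Order.TTheory GRing.Theory Num.Theory.
Local Open Scope ring_scope.

Set Implicit Arguments.
Unset Strict Implicit.
Unset Printing Implicit Defensive.

Section Replacement.
Variables (R : realFieldType) (n T q : nat).
Variable life : 'I_n -> nat -> nat.
Variables (cpr ccr : 'I_n -> R) (d : R).
Implicit Types (s : plan n) (i : 'I_n) (r t u : nat).

(** * Boolean feasibility and bounds on feasible plans *)

Definition feasibleb s : bool :=
  [forall i, [&& tau s i 0 == 0%N,
    all (fun r => (tau s i r.-1 < tau s i r <= failure_time life s i r)%N)
        (index_iota 1 (nrep s i).+1),
    (tau s i (nrep s i) <= T)%N
    & (T < failure_time life s i (nrep s i).+1)%N]].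

Lemma feasibleP s : reflect (feasible T life s) (feasibleb s).
Proof.
apply: (iffP forallP) => fs i.
  have /and4P[/eqP t0 /allP step le_T gt_T] := fs i.
  by split=> // r /andP[r1 rk];
    have /andP[] := step r ltac:(by rewrite mem_index_iota r1 ltnS).
have [t0 step le_T fail gt_T] := fs i.
rewrite t0 eqxx le_T gt_T /= andbT; apply/allP => r.
by rewrite mem_index_iota ltnS => rk; rewrite step // fail.
Qed.

Lemma feasible_tau_ltn s i r1 r2 : feasible T life s ->
  (r1 < r2 <= nrep s i)%N -> (tau s i r1 < tau s i r2)%N.
Proof.
move=> /(_ i)[_ step _ _ _] /andP[]; elim: r2 => // r2 IH.
rewrite ltnS leq_eqVlt => /predU1P[->|lt_r] le_k; first exact: (step r2.+1).
exact: ltn_trans (IH lt_r (ltnW le_k)) (step r2.+1 le_k).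
Qed.

Lemma feasible_tau_le s i r : feasible T life s ->
  (r <= nrep s i)%N -> (tau s i r <= T)%N.
Proof.
move=> fs; rewrite leq_eqVlt => /predU1P[->|lt_k]; first by have [] := fs i.
have [_ _ le_T _ _] := fs i; apply: leq_trans le_T; apply: ltnW.
by apply: feasible_tau_ltn; rewrite ?lt_k /=.
Qed.

Lemma feasible_leq_tau s i r : feasible T life s ->
  (r <= nrep s i)%N -> (r <= tau s i r)%N.
Proof.
move=> fs; elim: r => // r IH lt_k.
apply: leq_ltn_trans (IH (ltnW lt_k)) _.
by apply: feasible_tau_ltn; rewrite // ltnSn.
Qed.

Lemma feasible_nrep s i : feasible T life s -> (nrep s i <= T)%N.
Proof.
by move=> fs; apply: leq_trans (feasible_leq_tau fs _) (feasible_tau_le fs _).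
Qed.

(** * Existence of a latest optimal plan *)

Definition earliness s : nat :=
  \sum_(i < n) \sum_(1 <= r < (nrep s i).+1) (T.+1 - tau s i r)%N.

(** Values of [tau] beyond [nrep] are junk, so plans are compared only up to this relation. *)
Definition plan_agree s s' : Prop :=
  forall i, nrep s i = nrep s' i /\
    forall r, (r <= nrep s i)%N -> tau s i r = tau s' i r.

Section Agree.
Variables s s' : plan n.
Hypothesis ss' : plan_agree s s'.

Lemma agree_feasible : feasible T life s -> feasible T life s'.
Proof.
move=> fs i; have [t0 step le_T fail gt_T] := fs i.
have [ek et] := ss' i; rewrite /failure_time /= -ek -!et //; split=> //.
- by move=> r rk; rewrite -!et ?step //; lia.
- by move=> r rk; rewrite -!et ?fail //; lia.
Qed.

Lemma agree_group t : group q s t = group q s' t.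
Proof.
apply/setP=> [[i r]]; rewrite !inE /=; have [<- et] := ss' i.
by case: (leqP r (nrep s i)) => [rk|]; rewrite ?andbF // et.
Qed.

Lemma agree_cost : total_cost T q life cpr ccr d s
                 = total_cost T q life cpr ccr d s'.
Proof.
congr (_ + _); last by apply: eq_bigl => t; rewrite agree_group.
apply: eq_bigr => i _; have [<- et] := ss' i.
apply: eq_big_nat => r rk; rewrite /replacement_cost /failure_time.
by rewrite !et //; lia.
Qed.

Lemma agree_earliness : earliness s = earliness s'.
Proof.
apply: eq_bigr => i _; have [<- et] := ss' i.
by apply: eq_big_nat => r rk; rewrite et //; lia.
Qed.

End Agree.

(** In a feasible plan each [nrep] and each relevant time is at most [T]; a finite type thus covers
    all feasible plans up to [plan_agree], and minima over it exist. *)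
Definition plan_code : finType :=
  {ffun 'I_n -> 'I_T.+1 * {ffun 'I_T.+1 -> 'I_T.+1}}.

Definition decode (f : plan_code) : plan n :=
  Plan (fun i => (f i).1) (fun i r => (f i).2 (inord r)).

Lemma decode_surj s :
  feasible T life s -> exists f : plan_code, plan_agree s (decode f).
Proof.
move=> fs; exists [ffun i => (inord (nrep s i),
    [ffun r : 'I_T.+1 => inord (tau s i r)])].
move=> i; rewrite /= ffunE /= inordK ?ltnS ?feasible_nrep //; split=> // r rk.
have rT : (r <= T)%N by apply: leq_trans rk (feasible_nrep _ _).
by rewrite ffunE (inordK (m := r)) // inordK // ltnS feasible_tau_le.
Qed.

(** Two successive minimizations over the finite codes: first of the cost, then of [earliness] among
    the cheapest. *)
Lemma latest_optimal s0 : feasible T life s0 ->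
  exists2 s, optimal T q life cpr ccr d s &
    forall s', feasible T life s' ->
      total_cost T q life cpr ccr d s' <= total_cost T q life cpr ccr d s ->
      (earliness s <= earliness s')%N.
Proof.
move=> fs0; have [f0 e0] := decode_surj fs0.
pose F f := feasibleb (decode f).
pose C f := total_cost T q life cpr ccr d (decode f).
have Ff0 : F f0 by apply/feasibleP; apply: agree_feasible fs0.
case: (arg_minP C Ff0) => f1 Ff1 min1.
pose F1 f := F f && (C f <= C f1).
have F1f1 : F1 f1 by rewrite /F1 Ff1 lexx.
case: (arg_minnP (fun f => earliness (decode f)) F1f1).
move=> f2 /andP[Ff2 le21] min2; exists (decode f2).
  split=> [|s' fs']; first exact/feasibleP.
  have [f e] := decode_surj fs'; rewrite (agree_cost e).
  apply: le_trans le21 (min1 _ _).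
  by apply/feasibleP; apply: agree_feasible fs'.
move=> s' fs'; have [f e] := decode_surj fs'.
rewrite (agree_cost e) (agree_earliness e) => le_c; apply: min2.
rewrite /F1 (le_trans le_c le21) andbT.
by apply/feasibleP; apply: agree_feasible fs'.
Qed.

Lemma replace_every_period_feasible :
  (forall i r, (1 <= r <= T.+1)%N -> (0 < life i r)%N) ->
  feasible T life (Plan (fun=> T) (fun _ r => r)).
Proof.
move=> life_gt0 i; rewrite /failure_time /=; split=> // [r|r rT|]; first lia.
  by have := life_gt0 i r; lia.
by have := life_gt0 i T.+1; lia.
Qed.

(** * Used periods and the delayed plan *)

Definition used s u : bool :=
  [exists i, has (fun r => tau s i r == u) (index_iota 1 (nrep s i).+1)].

Lemma usedP s u :
  reflect (exists i r, (1 <= r <= nrep s i)%N /\ tau s i r = u) (used s u).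
Proof.
apply: (iffP existsP) => -[i].
  case/hasP=> r; rewrite mem_index_iota ltnS => rk /eqP eu.
  by exists i, r.
case=> r [rk eu]; exists i; apply/hasP; exists r; last exact/eqP.
by rewrite mem_index_iota ltnS.
Qed.

(** Since [nrep s i <= T <= q], every replaced individual has an index in ['I_q.+1]. *)
Lemma group_used s t : (T <= q)%N -> feasible T life s ->
  (group q s t != set0) = used s t.
Proof.
move=> Tq fs; apply/set0Pn/usedP => [[[i r]]|[i [r [rk et]]]].
  by rewrite inE /= => /andP[rk /eqP]; exists i, r.
have rq : (r < q.+1)%N by have := feasible_nrep i fs; lia.
by exists (i, Ordinal rq); rewrite inE /= rk et eqxx.
Qed.

(** A delay starts at time [t] and propagates along a run of consecutive periods. The value [false]
    at 0 keeps the initial time 0 fixed. *)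
Fixpoint delayed s t i r : bool :=
  if r is r'.+1 then
    (tau s i r == t) || delayed s t i r' && (tau s i r == (tau s i r').+1)
  else false.

Definition delay_tau s t i r : nat := (tau s i r + delayed s t i r)%N.

(** Times strictly increase, so only the last replacement can be pushed to [T.+1]; dropping one is
    enough. *)
Definition delay s t : plan n :=
  Plan (fun i => if (delay_tau s t i (nrep s i) <= T)%N then nrep s i
                 else (nrep s i).-1)
       (delay_tau s t).

Lemma delay_nrep s t i : (nrep (delay s t) i <= nrep s i)%N.
Proof. by rewrite /=; case: ifP => // _; apply: leq_pred. Qed.

Section Delay.
Variables (s : plan n) (t : nat).
Hypothesis fs : feasible T life s.
Hypothesis residual_gt1 : forall i r, (1 <= r <= nrep s i)%N ->
  tau s i r = t -> (t.+2 <= failure_time life s i r)%N.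

Lemma delay_lt i r : (1 <= r <= nrep s i)%N ->
  (delay_tau s t i r.-1 < delay_tau s t i r)%N.
Proof.
have [_ step _ _ _] := fs i.
case: r => // r /step /=; rewrite /delay_tau /=.
case: (delayed s t i r) => /=; last by lia.
by case: eqP => //= _; [lia | case: eqP => /= ?; lia].
Qed.

(** A replacement at [t] has residual life at least 2 and loses at most 1. A later delayed one has a
    delayed predecessor, so its residual life is unchanged; for an undelayed one it cannot
    shrink. *)
Lemma delay_le_failure i r : (1 <= r <= nrep s i)%N ->
  (delay_tau s t i r <= delay_tau s t i r.-1 + life i r)%N /\
  (delay_tau s t i r = (delay_tau s t i r.-1 + life i r)%N ->
   tau s i r = failure_time life s i r).
Proof.
move=> rk; have [_ _ _ fail _] := fs i.
have := fail r rk; have := residual_gt1 rk; case: r rk => // r rk.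
rewrite /failure_time /delay_tau /=.
case: eqP => [et /(_ et)|_ _] /=; first by case: (delayed s t i r) => /=; lia.
by case: (delayed s t i r) => /=; [case: eqP|] => /=; lia.
Qed.

Lemma delayed_used i r : (r <= nrep s i)%N -> delayed s t i r ->
  forall u, (t <= u <= tau s i r)%N -> used s u.
Proof.
elim: r => //= r IH rk /orP[/eqP et|/andP[dr /eqP et]] u.
  by rewrite et => ut; apply/usedP; exists i, r.+1; rewrite et; split=> //; lia.
rewrite et => ut; case: (leqP u (tau s i r)) => [le_u|gt_u].
  by apply: (IH (ltnW rk) dr); lia.
by apply/usedP; exists i, r.+1; rewrite et; split=> //; lia.
Qed.

Lemma delay_feasible : feasible T life (delay s t).
Proof.
move=> i; have [t0 _ le_T _ gt_T] := fs i.
have le_k := delay_nrep s t i.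
split.
- by rewrite /= /delay_tau /= t0.
- by move=> r rk; apply: delay_lt; lia.
- rewrite /=; case: ifP => // _; case: (posnP (nrep s i)) => [->|k_gt0].
    by rewrite /delay_tau /= t0.
  (* The dropped time is at most [T.+1], so the one before it is at most [T]. *)
  have := @delay_lt i (nrep s i); rewrite k_gt0 leqnn => /(_ isT).
  by rewrite {2}/delay_tau; case: (delayed s t i (nrep s i)) => /=; lia.
- by move=> r rk; have [] := @delay_le_failure i r; [lia|].
rewrite /failure_time /=; case: ifP => [_|].
  by move: gt_T; rewrite /failure_time /delay_tau /=; lia.
case: (posnP (nrep s i)) => [->|k_gt0]; first by rewrite /delay_tau /= t0.
(* The dropped time exceeds [T], and the individual fails no earlier than that time, hence after the
   horizon. *)
move/negbT; rewrite -ltnNge => gt; apply: leq_trans gt _.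
rewrite prednK //; have [] := @delay_le_failure i (nrep s i) => //; lia.
Qed.

Lemma delay_earliness : used s t -> (earliness (delay s t) < earliness s)%N.
Proof.
case/usedP=> i0 [r0 [rk0 et0]].
pose D i := (\sum_(1 <= r < (nrep s i).+1) (T.+1 - delay_tau s t i r))%N.
pose E i := (\sum_(1 <= r < (nrep s i).+1) delayed s t i r)%N.
have -> : earliness s = (\sum_(i < n) D i + \sum_(i < n) E i)%N.
  rewrite -big_split; apply: eq_bigr => i _; rewrite -big_split.
  apply: eq_big_nat => r rk; rewrite /delay_tau.
  (* As [tau s i r <= T], each delay lowers the weight [T.+1 - tau s i r] by exactly one. *)
  have := @feasible_tau_le s i r fs; case: (delayed _ _ _ _) => /=; lia.
have leD : (earliness (delay s t) <= \sum_(i < n) D i)%N.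
  apply: leq_sum => i _; rewrite /D.
  have le_k := delay_nrep s t i.
  by rewrite [leqRHS](big_cat_nat _ (n := (nrep (delay s t) i).+1)) //= leq_addr.
have gtE : (0 < \sum_(i < n) E i)%N.
  have D0 : delayed s t i0 r0.
    by case: r0 rk0 et0 => // r0 _ et0 /=; rewrite et0 eqxx.
  rewrite (bigD1 i0) //= /E (bigD1_seq r0) ?iota_uniq ?mem_index_iota //=.
  by rewrite D0.
lia.
Qed.

Lemma delay_replacement_cost i r : cpr i <= ccr i ->
  (1 <= r <= nrep s i)%N ->
  replacement_cost life cpr ccr (delay s t) i r
    <= replacement_cost life cpr ccr s i r.
Proof.
move=> le_c rk; have [_ corr] := delay_le_failure rk.
rewrite /replacement_cost; case: eqP => [/corr ->|_]; first by rewrite eqxx.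
by case: ifP.
Qed.

Lemma delayed_ge i r : delayed s t i r -> (t <= tau s i r)%N.
Proof.
elim: r => //= r IH /orP[/eqP ->|/andP[/IH le_t /eqP ->]] //.
exact: leqW.
Qed.

Lemma delay_used_count : (0 < t <= T)%N -> used s t ->
  (count (used (delay s t)) (index_iota 1 T.+1)
     <= count (used s) (index_iota 1 T.+1))%N.
Proof.
move=> t_range used_t.
have exx : exists x, (t < x)%N && ~~ used s x.
  exists T.+1; apply/andP; split; first lia.
  apply/usedP => -[i [r [rk et]]].
  by have := @feasible_tau_le s i r fs; lia.
case: (ex_minnP exx) => x /andP[tx nux] min_x.
set I := index_iota 1 T.+1.
have tI : t \in [seq u <- I | used s u].
  by rewrite mem_filter used_t mem_index_iota; lia.
rewrite -!size_filter (perm_size (perm_to_rem tI)) /=.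
rewrite -[leqRHS]/(size (x :: rem t [seq u <- I | used s u])).
apply: uniq_leq_size; first by rewrite filter_uniq ?iota_uniq.
move=> u; rewrite mem_filter => /andP[/usedP[i [r [rk eu]]] uI].
rewrite inE mem_rem_uniq ?filter_uniq ?iota_uniq // inE mem_filter uI andbT.
have le_k := delay_nrep s t i.
have rk' : (1 <= r <= nrep s i)%N by lia.
move: eu; rewrite /= /delay_tau; case dr: (delayed _ _ _ _) => eu.
  have us := delayed_used _ dr; case uu: (used s u).
    have := delayed_ge dr; case: eqP => //=; lia.
  rewrite andbF orbF eqn_leq min_x ?uu ?andbT //; last first.
    by have := delayed_ge dr; lia.
  by rewrite leqNgt; apply/negP=> xu; rewrite us in nux => //; lia.
have -> : used s u by apply/usedP; exists i, r; split=> //; lia.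
rewrite andbT; apply/orP; right; apply/eqP=> eut.
(* An undelayed replacement cannot sit at [t]. *)
by case: r rk' {rk} dr eu => //= r _; case: eqP => //; lia.
Qed.

End Delay.

(** * Cost comparison and conclusion *)

Lemma delay_cost (s : plan n) t :
  (T <= q)%N -> (forall i, 0 <= cpr i <= ccr i) -> 0 <= d ->
  feasible T life s ->
  (forall i r, (1 <= r <= nrep s i)%N ->
     tau s i r = t -> (t.+2 <= failure_time life s i r)%N) ->
  (0 < t <= T)%N -> used s t ->
  total_cost T q life cpr ccr d (delay s t) <= total_cost T q life cpr ccr d s.
Proof.
move=> Tq cost_bounds d_ge0 fs res t_range used_t.
have fs' := delay_feasible fs res.
apply: lerD.
  apply: ler_sum => i _; have /andP[cpr_ge0 le_c] := cost_bounds i.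
  have le_k := delay_nrep s t i.
  rewrite [leRHS](big_cat_nat _ (n := (nrep (delay s t) i).+1)) //.
  rewrite -[leLHS]addr0; apply: lerD.
    apply: ler_sum_nat => r rk.
    by apply: (delay_replacement_cost fs res le_c); lia.
  apply: sumr_ge0 => r _; rewrite /replacement_cost; case: ifP => // _.
  exact: le_trans le_c.
rewrite (eq_bigl _ _ (fun u => group_used u Tq fs')).
rewrite (eq_bigl _ _ (fun u => group_used u Tq fs)).
(* Each setup sum is [d] times the number of used periods. *)
rewrite !big_const_seq !iter_addr_0 ler_wpMn2l //.
exact: delay_used_count fs t_range used_t.
Qed.

End Replacement.

Theorem theorem1 (R : realFieldType) (n T q : nat) (life : 'I_n -> nat -> nat)
    (cpr ccr : 'I_n -> R) (d : R)
    (q_large : (T + 1 <= q)%N)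
    (life_gt0 : forall (i : 'I_n) (r : nat), (1 <= r <= q)%N -> (0 < life i r)%N)
    (cost_bounds : forall i : 'I_n, 0 <= cpr i < ccr i)
    (d_ge0 : 0 <= d) :
  exists s : plan n,
    optimal T q life cpr ccr d s /\
    forall t : nat, (1 <= t <= T)%N ->
      group q s t != set0 ->
      ~ (forall p : 'I_n * 'I_q.+1,
           p \in group q s t -> last_replaced s p.1 p.2) ->
      exists2 p : 'I_n * 'I_q.+1,
        p \in group q s t & (residual_life life s p.1 p.2 <= 1)%N.
Proof.
have Tq : (T <= q)%N by lia.
have life_gt0' i r : (1 <= r <= T.+1)%N -> (0 < life i r)%N.
  by move=> ?; apply: life_gt0; lia.
have cost_bounds' i : 0 <= cpr i <= ccr i.
  by have /andP[-> /ltW] := cost_bounds i.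
have [s opt_s late_s] :=
  latest_optimal q cpr ccr d (replace_every_period_feasible life_gt0').
have [fs _] := opt_s; exists s; split=> // t t_range.
rewrite (group_used _ Tq fs) => used_t _.
case: (boolP [exists p in group q s t, residual_life life s p.1 p.2 <= 1]%N).
  by case/exists_inP=> p; exists p.
move=> /exists_inPn res2.
have res i r : (1 <= r <= nrep s i)%N -> tau s i r = t ->
    (t.+2 <= failure_time life s i r)%N.
  move=> rk et; have rq : (r < q.+1)%N by have := feasible_nrep i fs; lia.
  have := res2 (i, Ordinal rq); rewrite inE /= rk et eqxx => /(_ isT).
  by rewrite /residual_life /= et; lia.
have le_cost := delay_cost Tq cost_bounds' d_ge0 fs res t_range used_t.
have := late_s _ (delay_feasible fs res) le_cost.
by rewrite leqNgt (delay_earliness fs).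
Qed.
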